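(* Let $m=2h+1\ge 5$ be odd and let $f_3(x)=x+x^3+x^{2^{h+1}+1}\in\mathbb{F}_{2^m}[x]$. Let $s^\infty$ be the sequence $s_t=\operatorname{Tr}(f_3(\alpha^t+1))$, $t\ge0$. Then the binary cyclic code $\mathcal{C}_s$ has parameters $[2^m-1,\,2^m-2-3m,\,8]$ and generator polynomial $$g_s(x)=(x-1)\,m_{\alpha^{-1}}(x)\,m_{\alpha^{-3}}(x)\,m_{\alpha^{-(2^h+1)}}(x).$$
   Context: Let $m\ge 1$, $v=2^m-1$, $\alpha$ a primitive element of $\mathbb{F}_{2^m}$, and $\operatorname{Tr}(x)=\sum_{i=0}^{m-1}x^{2^i}$ the absolute trace from $\mathbb{F}_{2^m}$ to $\mathbb{F}_2$. For a polynomial $F$ over $\mathbb{F}_{2^m}$ the binary sequence $s^\infty=(s_t)_{t\ge0}$ is defined by $s_t=\operatorname{Tr}(F(\alpha^t+1))$; it is periodic with period dividing $v$. Its minimal polynomial $g_s(x)$ is the polynomial $1+c_1x+\dots+c_Lx^L\in\mathbb{F}_2[x]$ of least degree $L$ such that $s_i+c_1s_{i-1}+\dots+c_Ls_{i-L}=0$ for all $i\ge L$; its degree $L_s$ is the linear span of $s^\infty$. $\mathcal{C}_s$ denotes the binary cyclic code of length $v$ with generator polynomial $g_s(x)$ (so $\dim\mathcal{C}_s=v-L_s$). For an integer $i$, $m_{\alpha^i}(x)$ is the minimal polynomial of $\alpha^i$ over $\mathbb{F}_2$. $[n,k,d]$ denotes length, dimension, minimum Hamming distance. *)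

(* Defs.v *)
From HB Require Import structures.
From mathcomp Require Import all_boot all_order all_algebra all_field.
Set Implicit Arguments. Unset Strict Implicit. Unset Printing Implicit Defensive.
Import GRing.Theory.
Local Open Scope ring_scope.

Definition f2_to (F : fieldType) (b : 'F_2) : F := (nat_of_ord b)%:R.

Definition trace_abs (F : fieldType) (m : nat) (x : F) : F :=
  \sum_(i < m) x ^+ (2 ^ i).

(* Binary value (0/1) of an element of F_{2^m} that lies in F_2. *)
Definition to_F2 (F : fieldType) (x : F) : 'F_2 := (x != 0)%:R.

Definition f3 (F : fieldType) (h : nat) (x : F) : F :=
  x + x ^+ 3 + x ^+ (2 ^ h.+1 + 1).

Definition trace_seq (F : fieldType) (m : nat) (P : F -> F) (alpha : F)
  (t : nat) : 'F_2 := to_F2 (trace_abs m (P (alpha ^+ t + 1))).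

Definition annihilates (s : nat -> 'F_2) (c : {poly 'F_2}) : Prop :=
  c`_0 = 1 /\
  forall i : nat, ((size c).-1 <= i)%N ->
    \sum_(j < size c) c`_j * s (i - j)%N = 0.

Definition is_seq_minpoly (s : nat -> 'F_2) (g : {poly 'F_2}) : Prop :=
  annihilates s g /\
  forall c : {poly 'F_2}, annihilates s c -> (size g <= size c)%N.

Definition is_minpoly_F2 (F : fieldType) (beta : F) (p : {poly 'F_2}) : Prop :=
  p \is monic /\ root (map_poly (@f2_to F) p) beta /\
  forall q : {poly 'F_2}, q != 0 -> root (map_poly (@f2_to F) q) beta ->
    (size p <= size q)%N.

Definition word_poly (n : nat) (c : 'rV['F_2]_n) : {poly 'F_2} :=
  \sum_(i < n) c 0 i *: 'X^i.

Definition cyclic_code (n : nat) (g : {poly 'F_2}) : {set 'rV['F_2]_n} :=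
  [set c : 'rV['F_2]_n | g %| word_poly c].

Definition code_dim (n : nat) (C : {set 'rV['F_2]_n}) : nat :=
  \dim (<< enum C >>%VS).

Definition hweight (n : nat) (c : 'rV['F_2]_n) : nat :=
  #|[set i : 'I_n | c 0 i != 0]|.

Definition min_dist_is (n : nat) (C : {set 'rV['F_2]_n}) (d : nat) : Prop :=
  (exists2 c, c \in C & c != 0 /\ hweight c = d) /\
  (forall c, c \in C -> c != 0 -> (d <= hweight c)%N).

(* Main.v *)
(* The sequence is a sum of powers of the [1 + 3m] distinct elements [alpha^e],
   [e] in the cyclotomic cosets of [0, 1, 3, 2^h + 1], which determines its
   minimal polynomial. For the distance, let [sigma x = x^(2^(h+1))], so that
   [sigma^2] is the squaring map: codewords are the even subsets [S] of [F^*]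
   such that the sums over [S] of [x], [x sigma(x)] and [x sigma^2(x)] vanish.
   These conditions are invariant under translation, so a codeword of weight 6
   yields four distinct nonzero elements, their sum being the fifth; they
   produce two pairs with the same minors in the Moore matrix with columns
   [1, sigma, sigma^2], hence with the same span over [F_2], which is too small.
   A 3-dimensional affine subspace avoiding 0 is a codeword of weight 8, because
   a polynomial of degree 2 sums to 0 over [F_2^3]. *)
Require Import Defs.
From HB Require Import structures.
From mathcomp Require Import all_boot all_order all_algebra all_field.
From mathcomp Require Import zify ring.
Set Implicit Arguments. Unset Strict Implicit. Unset Printing Implicit Defensive.
Import GRing.Theory.
Local Open Scope ring_scope.

(** * Nonexistence of nonempty even words of size below 8, for an abstract square root [sigma] of
    the squaring map *)

Section SmallWeight.

Variables (F : fieldType) (sigma : {rmorphism F -> F}).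
Hypothesis charF : 2%N \in [pchar F].
Hypothesis sigma2 : forall x, sigma (sigma x) = x ^+ 2.

Lemma char2_add_eq0 (x y : F) : x + y = 0 -> x = y.
Proof. by move/eqP; rewrite addr_eq0 oppr_pchar2 // => /eqP. Qed.

Lemma sigma_fixed (x : F) : sigma x = x -> x = 0 \/ x = 1.
Proof.
move=> sx; have /eqP : x * (x - 1) = 0 
  by have := sigma2 x; rewrite !sx mulrBr mulr1 -expr2 => <-; rewrite subrr.
by rewrite mulf_eq0 subr_eq0 => /orP[] /eqP; [left|right].
Qed.

(** The equation says that [y / x] is fixed by [sigma], hence by squaring, so it is 0 or 1. *)
Lemma moore2_eq0 (x y : F) :
  x != 0 -> x * sigma y = y * sigma x -> y = 0 \/ y = x.
Proof.
move=> x0 E; have sx0 : sigma x != 0 by rewrite fmorph_eq0.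
have /sigma_fixed[] : sigma (y / x) = y / x.
- by rewrite fmorph_div; apply/eqP; rewrite eqr_div // mulrC E.
- by move/eqP; rewrite mulf_eq0 invr_eq0 (negPf x0) orbF => /eqP; left.
- by move/divr1_eq; right.
Qed.

(* Dodgson condensation of the 3 x 3 Moore determinant reduces to the 2 x 2
   case. *)
Lemma moore3_eq0 (c d x : F) : c != 0 -> d != 0 -> d != c ->
  (c * sigma d - d * sigma c) * x ^+ 2 =
    (c * d ^+ 2 - d * c ^+ 2) * sigma x
    - sigma (c * sigma d - d * sigma c) * x ->
  x \in [:: 0; c; d; c + d].
Proof.
move=> c0 d0 dc E; have sc0 : sigma c != 0 by rewrite fmorph_eq0.
pose w := c * sigma d - d * sigma c; pose z := c * sigma x - x * sigma c.
have w0 : w != 0.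
  rewrite subr_eq0; apply/negP => /eqP /(moore2_eq0 c0)[] /eqP.
    by rewrite (negPf d0).
  by rewrite (negPf dc).
have /(moore2_eq0 w0)[] : w * sigma z = z * sigma w.
- move: E; rewrite /w /z !rmorphB !rmorphM !sigma2.
  move/eqP; rewrite -subr_eq0 => /eqP E; apply/eqP; rewrite -subr_eq0; apply/eqP.
  rewrite -[RHS](mulr0 (sigma c)) -[X in _ = _ * X]E; ring.
- move/subr0_eq/(moore2_eq0 c0) => [] ->; by rewrite !inE eqxx ?orbT.
- move=> /eqP; rewrite -subr_eq0 => /eqP zw.
  have /(moore2_eq0 c0)[] : c * sigma (x - d) = (x - d) * sigma c.
  + apply/eqP; rewrite -subr_eq0 -zw /w /z rmorphB; apply/eqP; ring.
  + by move/subr0_eq ->; rewrite !inE eqxx ?orbT.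
  + by move/eqP; rewrite subr_eq => /eqP ->; rewrite !inE eqxx ?orbT.
Qed.

(* The Moore determinant of [x, a, b] depends on [a, b] only through the two
   minors below, hence vanishes at [a] and [b] when computed with [c, d]. *)
Lemma eq_minors_span (a b c d : F) : c != 0 -> d != 0 -> d != c ->
  c * sigma d - d * sigma c = a * sigma b - b * sigma a ->
  c * d ^+ 2 - d * c ^+ 2 = a * b ^+ 2 - b * a ^+ 2 ->
  a \in [:: 0; c; d; c + d] /\ b \in [:: 0; c; d; c + d].
Proof.
move=> c0 d0 dc E1 E2; split; apply: moore3_eq0 => //;
  rewrite E1 E2 rmorphB !rmorphM !sigma2; ring.
Qed.

Lemma char2_mul2 (x : F) : 2 * x = 0.
Proof. by rewrite mulr_natl mulr2n addrr_pchar2. Qed.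

(** The primed letters are independent variables, so that one identity serves for the images under
    [sigma] and under [sigma] applied twice. *)
Lemma char2_minors (x y c d x' y' c' d' : F) :
  x * x' + y * y' + c * c' + d * d' + (x + y + c + d) * (x' + y' + c' + d') = 0 ->
  c * d' - d * c' = (x + c + d) * (y' + c' + d') - (y + c + d) * (x' + c' + d').
Proof.
move=> E; apply/eqP; rewrite -subr_eq0 -[X in _ == X](addr0 0) -{1}E.
(* The difference of the two sides and the left side of [E] agree over the integers up to twice this
   expression. Later calls of [char2_mul2] supply such halves in the same way. *)
rewrite -(char2_mul2 (- (x * x' + y * y' + c * c' + d * d')
  - d * c' - x * y' - x * c' - x * d' - c * y' - d * y')).
by apply/eqP; ring.
Qed.

(** The pairs [(c, d)] and [(x + c + d, y + c + d)] have equal minors, so [x] and [y] lie in the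
    span of [c] and [d]. Being nonzero and different from [c] and [d], both must equal [c + d],
    although they are distinct. *)
Lemma no_five_nonzero (x y c d : F) : uniq [:: 0; x; y; c; d] ->
  x * sigma x + y * sigma y + c * sigma c + d * sigma d
    + (x + y + c + d) * sigma (x + y + c + d) = 0 ->
  x * sigma (sigma x) + y * sigma (sigma y) + c * sigma (sigma c)
    + d * sigma (sigma d)
    + (x + y + c + d) * sigma (sigma (x + y + c + d)) = 0 -> False.
Proof.
rewrite !rmorphD /= !inE !negb_or ![0 == _]eq_sym -!andbA andbT.
case/and5P=> x0 y0 c0 d0 /and5P[xy xc xd yc /andP[yd cd]] E1 E2.
have spanE (z : F) : z != 0 -> z != c -> z != d ->
    z + c + d \in [:: 0; c; d; c + d] -> z = c + d.
  move=> z0 zc zd; rewrite !inE -addrA => /or4P[] /eqP H.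
  - exact: char2_add_eq0 H.
  - case/eqP: zd; apply: char2_add_eq0; apply: (addrI c).
    by rewrite addr0 -[RHS]H; ring.
  - case/eqP: zc; apply: char2_add_eq0; apply: (addrI d).
    by rewrite addr0 -[RHS]H; ring.
  - by case/eqP: z0; apply: (addIr (c + d)); rewrite H add0r.
have [] : x + c + d \in [:: 0; c; d; c + d] /\ y + c + d \in [:: 0; c; d; c + d].
  apply: eq_minors_span; rewrite // 1?eq_sym //.
    by rewrite !rmorphD; exact: char2_minors.
  by rewrite -!sigma2 !rmorphD; exact: char2_minors.
by move=> /spanE Hx /spanE Hy; rewrite Hx // Hy // eqxx in xy.
Qed.

Lemma no_small_even_word (s : seq F) :
  uniq s -> ~~ odd (size s) -> (size s < 8)%N ->
  \sum_(x <- s) x = 0 -> \sum_(x <- s) x * sigma x = 0 ->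
  \sum_(x <- s) x ^+ 3 = 0 -> s = [::].
Proof.
move=> U ev sz E0 E1 E3.
have {}E3 : \sum_(x <- s) x * sigma (sigma x) = 0.
  by rewrite -[RHS]E3; apply: eq_bigr => x _; rewrite sigma2 exprS.
(* Odd sizes and sizes from 8 on are discarded by computation; sizes 2, 4 and 6 remain. *)
case: s U ev sz E0 E1 E3 => [|a [|b [|c [|d [|e [|f [|? [|? s]]]]]]]] // U _ _;
  rewrite ?(big_cons, big_nil, addr0, addrA).
- by move=> /char2_add_eq0 ab; move: U; rewrite ab /= !inE eqxx.
(* Translating by [a] turns the word into 0, x, y, x + y, and [E1] into the vanishing of the Moore
   minor of [x] and [y]. *)
- move=> E0 E1 _; exfalso; move: U E0 E1.
  rewrite -(subrKC a b) -(subrKC a c).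
  move: (b - a) (c - a) => x y + /esym E0.
  have {E0} -> : d = a + x + y.
    apply: char2_add_eq0; rewrite E0 -[LHS]addr0 -(char2_mul2 a); ring.
  rewrite !rmorphD /= !inE !negb_or => U E1.
  have x0 : x != 0.
    by apply/eqP => x0; move: U; rewrite x0 addr0 eqxx.
  have /(moore2_eq0 x0)[] : x * sigma y = y * sigma x.
  + apply: char2_add_eq0; rewrite -[RHS]E1 -[LHS]addr0.
    rewrite -(char2_mul2 (2 * a * sigma a + a * (sigma x + sigma y)
      + (x + y) * sigma a + x * sigma x + y * sigma y)); ring.
  + by move=> y0; move: U; rewrite y0 addr0 eqxx /= andbF.
  + by move=> yx; move: U; rewrite yx /= eqxx /= andbF.
(* Translating by [a] leaves 0, four distinct nonzero elements and their sum; all terms involving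
   [a] occur an even number of times. *)
- move=> E0 E1 E3; exfalso; move: U E0 E1 E3.
  rewrite -(subrKC a b) -(subrKC a c) -(subrKC a d) -(subrKC a e).
  move: (b - a) (c - a) (d - a) (e - a) => x y z w + /esym E0.
  have {E0} -> : f = a + (x + y + z + w).
    apply: char2_add_eq0; rewrite E0 -[LHS]addr0 -(char2_mul2 (2 * a)); ring.
  move=> U E1 E3; apply: (@no_five_nonzero x y z w).
  + rewrite -(map_inj_uniq (addrI a)) [map _ _]/= addr0.
    exact: subseq_uniq
      (prefix_subseq [:: a; a + x; a + y; a + z; a + w] [:: _]) U.
  + rewrite -[RHS]E1 !rmorphD -[LHS]addr0.
    rewrite -(char2_mul2 (3 * a * sigma a + (x + y + z + w) * sigma a
       + a * (sigma x + sigma y + sigma z + sigma w))); ring.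
  + rewrite -[RHS]E3 !rmorphD -[LHS]addr0 -(char2_mul2 (3 * a * sigma (sigma a)
     + (x + y + z + w) * sigma (sigma a)
     + a * (sigma (sigma x) + sigma (sigma y) + sigma (sigma z) + sigma (sigma w))));
    ring.
Qed.

End SmallWeight.

(** * Frobenius powers, conjugates, and the dimension of a cyclic code *)

Definition frob (F : fieldType) (n : nat) (x : F) : F := x ^+ (2 ^ n).

(** Entries repeat when the Frobenius orbit of [x] has fewer than m elements; distinctness is a
    separate matter. *)
Definition conjugates (F : fieldType) (m : nat) (x : F) : seq F :=
  [seq frob i x | i <- iota 0 m].

Lemma F2_eq1 (b : 'F_2) : b != 0 -> b = 1.
Proof. by case: b => [[|[|?]] ?] // _; apply: val_inj. Qed.

Lemma word_polyE n (c : 'rV['F_2]_n) : word_poly c = rVpoly c.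
Proof.
rewrite [c in RHS]row_sum_delta linear_sum; apply: eq_bigr => i _.
by rewrite linearZ /= rVpoly_delta.
Qed.

(** The code is the image of the injective linear map [u] to [g * u] on polynomials of degree below
    n - deg g. *)
Lemma code_dim_cyclic n (g : {poly 'F_2}) : g != 0 -> ((size g).-1 <= n)%N ->
  code_dim (cyclic_code n g) = (n - (size g).-1)%N.
Proof.
move=> g0 gn; set d := (n - _)%N.
have gt0 : (0 < size g)%N by rewrite size_poly_gt0.
have sz (u : 'rV['F_2]_d) : (size (g * rVpoly u)%R <= n)%N.
  have [->|u0] := eqVneq (rVpoly u) 0; first by rewrite mulr0 size_poly0.
  rewrite size_mul // -(subnKC gn) -/d.
  by rewrite -{1}(ltn_predK gt0) leq_add2l size_poly.
pose f0 (u : 'rV['F_2]_d) : 'rV['F_2]_n := poly_rV (g * rVpoly u).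
have f0_linear : linear f0.
  by move=> a u v; rewrite /f0 linearP mulrDr -scalerAr linearP.
pose f1 : {linear 'rV['F_2]_d -> 'rV['F_2]_n} :=
  HB.pack f0 (GRing.isLinear.Build _ _ _ _ f0 f0_linear).
pose f := linfun f1.
have fE u : rVpoly (f u) = g * rVpoly u by rewrite lfunE /= poly_rV_K.
suff -> : code_dim (cyclic_code n g) = \dim (limg f).
  rewrite limg_dim_eq ?dimvf ?/dim /= ?mul1n //; apply/eqP; rewrite capfv.
  apply/lker0P => u v /(congr1 rVpoly); rewrite !fE => /(mulfI g0).
  exact: (can_inj rVpolyK).
congr (\dim _); apply/eqP; rewrite eqEsubv; apply/andP; split.
  apply/span_subvP => c; rewrite mem_enum inE word_polyE => /dvdpP[u uE].
  have su : (size u <= d)%N.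
    have [->|u0] := eqVneq u 0; first by rewrite size_poly0.
    have : (size (rVpoly c) <= n)%N by exact: size_poly.
    rewrite uE size_mul // -(ltn_predK gt0) addnS /= => H.
    by rewrite /d leq_subRL // addnC.
  apply/memv_imgP; exists (poly_rV u); first exact: memvf.
  by apply: (can_inj rVpolyK); rewrite fE poly_rV_K // uE mulrC.
apply/subvP => _ /memv_imgP[u _ ->]; apply: memv_span.
by rewrite mem_enum inE word_polyE fE dvdp_mulIl.
Qed.

(** * Characteristic 2: the embedding of F_2, Frobenius morphisms, and minimal polynomials over
    F_2 *)

Section Char2.

Variable F : fieldType.
Hypothesis charF : 2%N \in [pchar F].

Lemma f2_to_zmod_morphism : zmod_morphism (@f2_to F).
Proof.
move=> a b; rewrite -[a - b]/(a + - b) oppr_pchar2 ?pchar_Fp //.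
rewrite [RHS]addrC oppr_pchar2 // addrC /f2_to -natrD.
by rewrite -[RHS](GRing.natr_mod_pchar charF).
Qed.

Lemma f2_to_monoid_morphism : monoid_morphism (@f2_to F).
Proof.
split=> // a b; rewrite /f2_to -natrM -[RHS](GRing.natr_mod_pchar charF) //.
Qed.

HB.instance Definition _ :=
  GRing.isZmodMorphism.Build 'F_2 F (@f2_to F) f2_to_zmod_morphism.
HB.instance Definition _ :=
  GRing.isMonoidMorphism.Build 'F_2 F (@f2_to F) f2_to_monoid_morphism.

Lemma frob_zmod_morphism n : zmod_morphism (@frob F n).
Proof.
move=> a b; rewrite /frob !oppr_pchar2 // exprDn_pchar //.
by rewrite pnatX (eq_pnat _ (pcharf_eq charF)) pnat_id.
Qed.

Lemma frob_monoid_morphism n : monoid_morphism (@frob F n).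
Proof. by split=> [|a b]; rewrite /frob ?expr1n ?exprMn. Qed.

HB.instance Definition _ n :=
  GRing.isZmodMorphism.Build F F (@frob F n) (frob_zmod_morphism n).
HB.instance Definition _ n :=
  GRing.isMonoidMorphism.Build F F (@frob F n) (frob_monoid_morphism n).

Lemma frob0 (x : F) : frob 0 x = x. Proof. by rewrite /frob expr1. Qed.

Lemma frob_frob i j (x : F) : frob i (frob j x) = frob (j + i) x.
Proof. by rewrite /frob -exprM -expnD. Qed.

Lemma to_F2K (x : F) : x ^+ 2 = x -> f2_to F (to_F2 x) = x.
Proof.
move=> x2; have /eqP : x * (x - 1) = 0 by rewrite mulrBr mulr1 -expr2 x2 subrr.
rewrite mulf_eq0 subr_eq0 => /orP[] /eqP ->.
  by rewrite /to_F2 eqxx rmorph0.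
by rewrite /to_F2 oner_eq0 rmorph1.
Qed.

Lemma frob_horner_F2 n (c : {poly 'F_2}) (x : F) :
  frob n (map_poly (@f2_to F) c).[x] = (map_poly (@f2_to F) c).[frob n x].
Proof.
rewrite -horner_map -map_poly_comp; congr (_.[_]).
by apply: eq_map_poly => b; rewrite /= /f2_to rmorph_nat.
Qed.

Lemma all_root_conjugates m (c : {poly 'F_2}) (x : F) : (0 < m)%N ->
  all (root (map_poly (@f2_to F) c)) (conjugates m x) =
  root (map_poly (@f2_to F) c) x.
Proof.
move=> m0; apply/allP/idP => [H|H _ /mapP[i _ ->]].
  by apply: H; apply/mapP; exists 0%N; rewrite ?frob0 ?mem_iota.
by rewrite /root -frob_horner_F2 fmorph_eq0.
Qed.

(** The product is Frobenius-invariant, so its coefficients lie in F_2 and minimality bounds the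
    degree of [p] by its degree. Conversely every conjugate is a root of [p]. *)
Lemma minpoly_prod_conjugates m (x : F) (p : {poly 'F_2}) :
  (0 < m)%N -> frob m x = x -> uniq (conjugates m x) -> is_minpoly_F2 x p ->
  map_poly (@f2_to F) p = \prod_(r <- conjugates m x) ('X - r%:P).
Proof.
move=> m0 mx U [mon [rt min]]; set Q := \prod_(r <- _) _.
have monQ : Q \is monic by exact: monic_prod_XsubC.
have QE : map_poly (frob 1) Q = Q.
  rewrite /Q /conjugates !big_map.
  have -> : iota 0 m = index_iota 0 m by rewrite /index_iota subn0.
  rewrite rmorph_prod /=.
  (* Frobenius shifts the factors cyclically; the last one wraps around because [frob m x = x]. *)
  case: m m0 mx {U Q monQ} => // m _ mx; rewrite big_nat_recr // big_nat_recl //=.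
  rewrite mulrC frob0; congr (_ * _).
    by rewrite map_polyXsubC /= frob_frob addn1 mx.
  by apply: eq_bigr => i _; rewrite map_polyXsubC /= frob_frob addn1.
pose q := map_poly (@to_F2 F) Q.
have qQ : map_poly (@f2_to F) q = Q.
  apply/polyP => i; rewrite coef_map /= coef_map_id0; last by rewrite /to_F2 eqxx.
  by apply: to_F2K; rewrite -[in RHS]QE coef_map.
have QdP : Q %| map_poly (@f2_to F) p.
  apply: uniq_roots_dvdp; last by rewrite uniq_rootsE.
  by rewrite all_root_conjugates.
have := @dvdp_leq _ _ _ _ QdP; rewrite map_poly_eq0 monic_neq0 // => /(_ isT) le1.
apply/esym/eqP; rewrite -eqp_monic ?monic_map // -dvdp_size_eqp // eqn_leq le1.
rewrite -qQ !size_map_poly min //.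
  by rewrite -(map_poly_eq0 (@f2_to F)) qQ monic_neq0.
rewrite qQ root_prod_XsubC; apply/mapP; exists 0%N; by rewrite ?frob0 ?mem_iota.
Qed.

(** * The minimal polynomial of a sum of geometric sequences *)

Section Sequence.

Variables (s : nat -> 'F_2) (R : seq F).
Hypotheses (uniqR : uniq R) (R0 : 0 \notin R).
Hypothesis sE : forall t, f2_to F (s t) = \sum_(r <- R) r^-1 ^+ t.

(** Since the sequence sums powers of [r^-1], the recurrence evaluates [c] at [r] itself. The bound
    on [i] keeps the subtraction [i - j] exact. *)
Lemma f2_to_convolution (c : {poly 'F_2}) i : ((size c).-1 <= i)%N ->
  f2_to F (\sum_(j < size c) c`_j * s (i - j)%N) =
  \sum_(r <- R) (map_poly (@f2_to F) c).[r] * r^-1 ^+ i.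
Proof.
move=> ci; rewrite rmorph_sum /=.
under eq_bigr do rewrite rmorphM /= sE mulr_sumr.
rewrite exchange_big /=; apply: eq_big_seq => r rR.
have r0 : r != 0 by apply: contraNneq R0 => <-.
rewrite horner_coef size_map_poly mulr_suml; apply: eq_bigr => j _.
rewrite coef_map -mulrA; congr (_ * _).
have ji : (j <= i)%N by rewrite (leq_trans _ ci) // -ltnS (ltn_predK (ltn_ord j)).
by rewrite -{2}(subnKC ji) exprD mulrA -exprMn divff // expr1n mul1r.
Qed.

(* Testing the vanishing power sums against Lagrange-type polynomials isolates
   each coefficient. *)
Lemma annihilatesP (c : {poly 'F_2}) :
  annihilates s c <-> c`_0 = 1 /\ all (root (map_poly (@f2_to F) c)) R.
Proof.
split=> [[c0 H]|[c0 /allP H]]; split=> //; last first.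
  move=> i ci; apply/eqP; rewrite -(fmorph_eq0 (@f2_to F)) /=.
  rewrite f2_to_convolution // big_seq big1 // => r.
  by move/H/rootP ->; rewrite mul0r.
set C := map_poly _ _; pose d := (size c).-1.
have HP (P : {poly F}) : \sum_(r <- R) C.[r] * r^-1 ^+ d * P.[r^-1] = 0.
  under eq_bigr do rewrite (horner_coef P) mulr_sumr.
  rewrite exchange_big big1 //= => i _.
  under eq_bigr do rewrite mulrCA -mulrA -exprD.
  rewrite -mulr_sumr -f2_to_convolution ?leq_addr // H ?leq_addr //.
  by rewrite rmorph0 mulr0.
apply/allP => r rR; have r0 : r != 0 by apply: contraNneq R0 => <-.
have [P Pr Pt] : exists2 P : {poly F}, P.[r^-1] != 0 &
    forall t, t \in R -> t != r -> P.[t^-1] = 0.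
  exists (\prod_(t <- rem r R) ('X - (t^-1)%:P)) => [|t tR tr].
    rewrite horner_prod prodf_seq_neq0; apply/allP=> t.
    rewrite mem_rem_uniq // !inE hornerXsubC subr_eq0 => /andP[tr _].
    by rewrite (inj_eq invr_inj) eq_sym.
  apply/eqP; rewrite horner_prod prodf_seq_eq0; apply/hasP; exists t.
    by rewrite mem_rem_uniq // inE tr.
  by rewrite hornerXsubC subrr eqxx.
have := HP P; rewrite (bigD1_seq r) //= big_seq_cond big1 => [/eqP|t].
  rewrite addr0 !mulf_eq0 (negPf Pr) orbF expf_eq0 invr_eq0 (negPf r0) andbF orbF.
  by [].
by case/andP=> tR tr; rewrite Pt ?mulr0.
Qed.

(** By [annihilatesP], [g] annihilates the sequence and divides every annihilator. Nonzero
    polynomials over F_2 are monic, so an annihilator of the same size is [g]. *)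
Lemma seq_minpoly_prod (g : {poly 'F_2}) :
  map_poly (@f2_to F) g = \prod_(r <- R) ('X - r%:P) ->
  is_seq_minpoly s g /\ (forall g', is_seq_minpoly s g' -> g' = g).
Proof.
move=> gE.
have ann : annihilates s g.
  apply/annihilatesP; split; last first.
    by rewrite gE; apply/allP=> r; rewrite root_prod_XsubC.
  apply: F2_eq1; rewrite -(fmorph_eq0 (@f2_to F)) -coef_map gE -horner_coef0.
  by rewrite -[_ == _]/(root _ 0) root_prod_XsubC.
have dv c : annihilates s c -> g %| c.
  case/annihilatesP => _ rc; rewrite -(dvdp_map (@f2_to F)) gE.
  by apply: uniq_roots_dvdp; rewrite ?uniq_rootsE.
have nz c : annihilates s c -> c != 0.
  by case=> c0 _; apply: contra_eq_neq c0 => ->; rewrite coef0 eq_sym oner_eq0.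
have mon c : annihilates s c -> c \is monic.
  by move/nz=> c0; rewrite monicE; apply/eqP/F2_eq1; rewrite lead_coef_eq0.
split; first by split=> // c ac; rewrite dvdp_leq ?dv ?nz.
move=> g' [ag' mg']; apply/esym/eqP.
rewrite -eqp_monic ?mon // -dvdp_size_eqp ?dv // eqn_leq mg' // andbT.
by rewrite dvdp_leq ?dv ?nz.
Qed.

End Sequence.


(** * Three-dimensional affine subspaces over F_2 *)

Lemma doubling (s : seq F) z : uniq s -> {in s &, forall x y, x + y \in s} ->
  z \notin s -> uniq (s ++ map (+%R z) s) /\
  {in s ++ map (+%R z) s &, forall x y, x + y \in s ++ map (+%R z) s}.
Proof.
move=> us cs zs; split.
  rewrite cat_uniq us (map_inj_uniq (addrI z)) us andbT /=.
  apply/hasPn => _ /mapP[x xs ->]; apply: contra zs => /cs /(_ xs).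
  by rewrite -addrA addrr_pchar2 // addr0.
move=> x y; rewrite !mem_cat => /orP[xs|/mapP[x' xs ->]] /orP[ys|/mapP[y' ys ->]].
- by rewrite cs.
- by rewrite addrCA [X in _ || X]map_f ?orbT // cs.
- by rewrite -addrA [X in _ || X]map_f ?orbT // cs.
- by rewrite addrACA addrr_pchar2 // add0r cs.
Qed.

(** The translate by [a] of the F_2-span of [x], [y], [z], in the order that three applications of
    [doubling] to [[:: 0]] produce. *)
Definition flat (a x y z : F) : seq F :=
  [seq a + u | u <- [:: 0; x; y; y + x; z; z + x; z + y; z + (y + x)]].

Lemma uniq_flat (a x y z : F) : x != 0 -> y \notin [:: 0; x] ->
  z \notin [:: 0; x; y; y + x] -> uniq (flat a x y z).
Proof.
move=> x0 y0 z0; rewrite (map_inj_uniq (addrI a)).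
have [u1 c1] : uniq [:: 0; x] /\ {in [:: 0; x] &, forall s t, s + t \in [:: 0; x]}.
  have := @doubling [:: 0] x isT; rewrite /= addr0; apply; last by rewrite inE.
  by move=> s t; rewrite !inE => /eqP -> /eqP ->; rewrite addr0.
have [u2 c2] := doubling u1 c1 y0.
rewrite [cat _ _]/= addr0 in u2 c2.
by have [+ _] := doubling u2 c2 z0; rewrite [cat _ _]/= addr0.
Qed.

Lemma sum_flat a x y z : \sum_(u <- flat a x y z) u = 0.
Proof.
rewrite /flat big_map ?(big_cons, big_nil).
rewrite -[RHS](char2_mul2 charF (4 * a + 2 * (x + y + z))); ring.
Qed.

(** The summand is quadratic in the three F_2-coordinates of [u], so each monomial of the sum has an
    even coefficient. *)
Lemma sum_flat_mul (tau : {rmorphism F -> F}) a x y z :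
  \sum_(u <- flat a x y z) u * tau u = 0.
Proof.
rewrite /flat big_map ?(big_cons, big_nil) !rmorphD rmorph0.
rewrite -[RHS](char2_mul2 charF (4 * a * tau a
  + 2 * a * (tau x + tau y + tau z) + 2 * tau a * (x + y + z)
  + 2 * (x * tau x + y * tau y + z * tau z)
  + x * tau y + x * tau z + y * tau x + y * tau z + z * tau x + z * tau y)).
ring.
Qed.

(** * The absolute trace and disjointness of conjugacy classes *)

Section Trace.

Variable m : nat.
Hypothesis m_odd : odd m.
Hypothesis frobm : forall x : F, frob m x = x.

Lemma trace_absE (x : F) : trace_abs m x = \sum_(0 <= i < m) frob i x.
Proof. by rewrite big_mkord. Qed.

Lemma trace_absD (x y : F) : trace_abs m (x + y) = trace_abs m x + trace_abs m y.
Proof.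
by rewrite !trace_absE -big_split; apply: eq_bigr => i _; rewrite rmorphD.
Qed.

Lemma trace_abs1 : trace_abs m (1 : F) = 1.
Proof.
rewrite trace_absE; under eq_bigr do rewrite rmorph1.
rewrite sumr_const_nat subn0 -(GRing.natr_mod_pchar charF) modn2.
by rewrite m_odd.
Qed.

Lemma trace_abs_sqr (x : F) : trace_abs m x ^+ 2 = trace_abs m (x ^+ 2).
Proof.
rewrite -[LHS]/(frob 1 _) !trace_absE rmorph_sum; apply: eq_bigr => i _ /=.
by rewrite -[x ^+ 2]/(frob 1 x) !frob_frob addnC.
Qed.

Lemma trace_abs_frob1 (x : F) : trace_abs m (frob 1 x) = trace_abs m x.
Proof.
rewrite !trace_absE; under eq_bigr do rewrite frob_frob add1n.
case: m m_odd frobm => // n _ mx.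
by rewrite big_nat_recr // big_nat_recl //= mx frob0 addrC.
Qed.

Lemma trace_abs_frob n (x : F) : trace_abs m (frob n x) = trace_abs m x.
Proof.
elim: n => [|n IH]; first by rewrite frob0.
by rewrite -addn1 -frob_frob trace_abs_frob1.
Qed.

Lemma trace_abs_F2 (x : F) : f2_to F (to_F2 (trace_abs m x)) = trace_abs m x.
Proof. by apply: to_F2K; rewrite trace_abs_sqr (trace_abs_frob 1). Qed.

(** Applying [frob (m - j)] undoes [frob j]; the resulting exponent is reduced modulo [m]. *)
Lemma frob_conj (x y : F) i j : (i < m)%N -> (j < m)%N ->
  frob i x = frob j y -> exists2 k, (k < m)%N & frob k x = y.
Proof.
move=> im jm /(congr1 (frob (m - j))); rewrite !frob_frob subnKC 1?ltnW // frobm.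
have [ij|ij] := ltnP i j => <-.
  exists (i + (m - j))%N => //; rewrite addnBA ?(ltnW jm) // ltn_subLR ?ltn_add2r //.
  by rewrite (leq_trans (ltnW jm)) ?leq_addl.
exists (i - j)%N; first exact: leq_ltn_trans (leq_subr _ _) im.
have -> : (i + (m - j) = m + (i - j))%N.
  by rewrite addnC addnBAC ?(ltnW jm) // addnBA.
by rewrite -frob_frob frobm.
Qed.

Lemma conjugates_disjoint (x y : F) : (forall k, (k < m)%N -> frob k x != y) ->
  ~~ has (mem (conjugates m x)) (conjugates m y).
Proof.
move=> H; apply/hasPn => _ /mapP[j jm ->]; apply/negP => /mapP[i im].
rewrite !mem_iota /= !add0n in im jm => /esym/(frob_conj im jm)[k km /eqP].
by apply/negP/H.
Qed.

End Trace.

(** * The sequence of [f3] and the roots of the generator polynomial *)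

Section Code.

Variables (h : nat) (gamma : F).
Let m := (2 * h + 1)%N.
Let v := (2 ^ m).-1.
Hypothesis frobm : forall x : F, frob m x = x.

(** Here [gamma] stands for the inverse of [alpha], matching the negative exponents in the generator
    polynomial. *)
Definition code_roots : seq F :=
  1 :: conjugates m gamma ++ conjugates m (gamma ^+ 3)
    ++ conjugates m (gamma ^+ (2 ^ h + 1)).

Lemma m_odd : odd m. Proof. by rewrite /m addn1 /= oddM. Qed.

(** Expanding leaves terms [frob n y + y], of trace 0. Since 2h + 1 = m, [frob h] carries the
    product of [frob h.+1 y] and [y] to the product of [y] and [frob h y], with the same trace. *)
Lemma trace_f3 (y : F) : trace_abs m (f3 h (y + 1)) =
  1 + trace_abs m y + trace_abs m (y ^+ 3) + trace_abs m (y ^+ (2 ^ h + 1)).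
Proof.
have powE n (x : F) : x ^+ (2 ^ n + 1) = frob n x * x by rewrite addn1 exprSr.
have -> : f3 h (y + 1) = 1 + y + y ^+ 3 + frob h.+1 y * y
    + (frob 1 y + y) + (frob h.+1 y + y).
  rewrite /f3 powE rmorphD rmorph1 /= -[LHS]addr0.
  rewrite -[X in _ + X = _](char2_mul2 charF (- (1 + y + y ^+ 2))).
  rewrite /frob expn1; ring.
rewrite !trace_absD !(trace_abs_frob m_odd frobm) !addrr_pchar2 // !addr0.
rewrite (trace_abs1 m_odd) powE; congr (_ + _).
rewrite -(trace_abs_frob m_odd frobm h) rmorphM /= frob_frob.
by rewrite (_ : h.+1 + h = m)%N ?frobm 1?mulrC // /m; lia.
Qed.

Lemma trace_seq_code_roots t :
  f2_to F (trace_seq m (f3 h) gamma^-1 t) = \sum_(r <- code_roots) r^-1 ^+ t.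
Proof.
have sumE e : \sum_(r <- conjugates m (gamma ^+ e)) r^-1 ^+ t =
    trace_abs m ((gamma^-1 ^+ t) ^+ e).
  rewrite big_map trace_absE /index_iota subn0; apply: eq_bigr => i _.
  by rewrite /frob !exprVn -!exprM; congr (gamma ^+ _)^-1; lia.
rewrite /trace_seq (trace_abs_F2 m_odd frobm) trace_f3 big_cons !big_cat /=.
by have := sumE 1%N; rewrite !expr1 => ->; rewrite !sumE invr1 expr1n !addrA.
Qed.

Hypothesis prim : v.-primitive_root gamma.
Hypothesis h_ge2 : (2 <= h)%N.

Lemma pow2h_ge4 : (4 <= 2 ^ h)%N. Proof. by rewrite (@leq_exp2l 2 2). Qed.

Lemma pow2m : (2 ^ m = 2 * (2 ^ h * 2 ^ h))%N.
Proof. by rewrite /m addn1 expnS (mul2n h) -addnn expnD. Qed.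

Lemma code_lengthE : v = (2 * (2 ^ h * 2 ^ h - 1) + 1)%N.
Proof. by rewrite /v pow2m; have := pow2h_ge4; nia. Qed.

Lemma pow2_lt k : (k < m)%N -> (2 * 2 ^ k <= 2 ^ m)%N.
Proof. by move=> km; rewrite -expnS leq_exp2l. Qed.

(** By [code_lengthE], [v] is 1 modulo every such [e]; this covers both 3 and 2^h + 1. *)
Lemma coprime_length e : (e %| 2 ^ h * 2 ^ h - 1)%N -> coprime e v.
Proof.
by case/dvdnP=> k; rewrite code_lengthE => ->; rewrite mulnA /coprime gcdnMDl gcdn1.
Qed.

Lemma coprime_length3 : coprime 3 v.
Proof.
apply: coprime_length; rewrite -expnD addnn -mul2n expnM.
rewrite -(@eqn_mod_dvd 3 _ 1) ?expn_gt0 //.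
by rewrite -modnXm exp1n.
Qed.

Lemma coprime_length_pow2h1 : coprime (2 ^ h + 1) v.
Proof.
apply: coprime_length; apply/dvdnP; exists (2 ^ h - 1)%N.
by have := pow2h_ge4; nia.
Qed.

Lemma gamma_expr_eq i j : (i < v)%N -> (j < v)%N ->
  (gamma ^+ i == gamma ^+ j) = (i == j).
Proof. by move=> iv jv; rewrite (eq_prim_root_expr prim) !modn_small. Qed.

Lemma gamma_neq0 : gamma != 0.
Proof.
apply/eqP => g0; have := prim_expr_order prim; rewrite g0 expr0n.
have := prim_order_gt0 prim; case: (v) => //= n _ /eqP.
by rewrite eq_sym oner_eq0.
Qed.

(** The element [gamma ^+ e] is again primitive, and the exponents 2^i with i < m are distinct and
    below [v]. *)
Lemma uniq_conjugates e : coprime e v -> uniq (conjugates m (gamma ^+ e)).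
Proof.
move=> ce; have pe : v.-primitive_root (gamma ^+ e) by rewrite prim_root_exp_coprime.
rewrite map_inj_in_uniq ?iota_uniq // => i j; rewrite !mem_iota /= !add0n.
move=> /pow2_lt im /pow2_lt jm /eqP; rewrite (eq_prim_root_expr pe).
have := pow2m; have := pow2h_ge4 => H4 mE.
by rewrite !modn_small ?eqn_exp2l //; [move/eqP|rewrite /v; nia..].
Qed.

Lemma pow2_neq_odd k n : odd n -> (1 < n)%N -> (2 ^ k == n)%N = false.
Proof.
by case: k => [|k] on n1; apply/eqP => E; move: on n1; rewrite -E // oddX.
Qed.

(** Comparing exponents modulo [v]: a power of 2 is neither 3 nor 2^h + 1, both odd, and 3 * 2^k is
    not congruent to 2^h + 1. *)
Lemma uniq_code_roots : uniq code_roots.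
Proof.
have H4 := pow2h_ge4; have vE := code_lengthE; have mE := pow2m.
have oddH : odd (2 ^ h + 1) by rewrite addn1 /= oddX; case: (h) h_ge2.
have no1 e : (0 < e < v)%N -> 1 \notin conjugates m (gamma ^+ e).
  case/andP=> e0 ev; apply/negP => /mapP[i _ /esym].
  rewrite -[in RHS](rmorph1 (frob i)) => /fmorph_inj /eqP.
  by rewrite -[1](expr0 gamma) gamma_expr_eq // ?(leq_ltn_trans _ ev) // eqn0Ngt e0.
rewrite /code_roots /= !mem_cat !negb_or.
rewrite -[in X in [&& X, _ & _]](expr1 gamma) !no1 /=; [|nia..].
rewrite !cat_uniq has_cat negb_or -{1}(expr1 gamma) !uniq_conjugates ?coprime1n
  ?coprime_length3 ?coprime_length_pow2h1 //= andbT.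
have small k : (k < m)%N -> (2 ^ k < v)%N by move/pow2_lt; nia.
rewrite -?andbA; apply/and3P.
split; apply: (conjugates_disjoint frobm) => k km; rewrite /frob.
- by rewrite gamma_expr_eq ?small ?pow2_neq_odd //; nia.
- by rewrite gamma_expr_eq ?small ?pow2_neq_odd //; nia.
- rewrite -exprM; have [k1|] := ltnP k.+1 m.
    have := pow2_lt k1; rewrite expnS => k2.
    rewrite gamma_expr_eq; [|nia..].
    by case: k {km k1 k2} => [|k]; [lia|rewrite expnS; lia].
  (* Only k = 2h makes 3 * 2^k exceed [v]; it reduces to 2^(2h) + 1. *)
  rewrite /m addn1 ltnS => k1.
  have kE : k = (h + h)%N by rewrite /m in km; lia.
  rewrite kE expnD (_ : _ * _ = v + (2 ^ h * 2 ^ h + 1))%N; last by nia.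
  rewrite exprD (prim_expr_order prim) mul1r gamma_expr_eq; [|nia..].
  by apply/eqP; nia.
Qed.

Lemma code_roots_neq0 : 0 \notin code_roots.
Proof.
have no0 e : 0 \notin conjugates m (gamma ^+ e).
  apply/negP => /mapP[i _ /esym/eqP].
  by rewrite !expf_eq0 (negPf gamma_neq0) !andbF.
by rewrite inE eq_sym oner_eq0 /= !mem_cat -{1}(expr1 gamma) !negb_or !no0.
Qed.

Lemma size_code_roots : size code_roots = (1 + 3 * m)%N.
Proof. by rewrite /= !size_cat !size_map !size_iota; lia. Qed.

(** As [w] has coefficients in F_2, one representative of each conjugacy class is enough to test. *)
Lemma dvdp_code_roots (g w : {poly 'F_2}) :
  map_poly (@f2_to F) g = \prod_(r <- code_roots) ('X - r%:P) ->
  (g %| w) = all (fun e => root (map_poly (@f2_to F) w) (gamma ^+ e))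
                 [:: 0; 1; 3; 2 ^ h + 1]%N.
Proof.
move=> gE; rewrite -(dvdp_map (@f2_to F)) gE /= expr0 expr1 andbT.
have m0 : (0 < m)%N by rewrite /m addn1.
rewrite -(all_root_conjugates _ gamma m0) -(all_root_conjugates _ (gamma ^+ 3) m0).
rewrite -(all_root_conjugates _ (gamma ^+ (2 ^ h + 1)) m0) -!all_cat.
rewrite -[RHS]/(all (root _) code_roots); apply/idP/idP => [/dvdpP[q ->]|H].
  by apply/allP => r rR; rewrite rootM root_prod_XsubC rR orbT.
by apply: uniq_roots_dvdp; rewrite // uniq_rootsE uniq_code_roots.
Qed.

(** * Codewords as subsets of F^*, and the minimum distance *)

Definition support_points (c : 'rV['F_2]_v) : seq F :=
  [seq gamma ^+ (i : 'I_v) | i <- enum [set i : 'I_v | c 0 i != 0]].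

Lemma size_support_points c : size (support_points c) = hweight c.
Proof. by rewrite size_map -cardE. Qed.

Lemma uniq_support_points c : uniq (support_points c).
Proof.
rewrite map_inj_uniq ?enum_uniq // => i j /eqP.
by rewrite gamma_expr_eq // => /eqP/val_inj.
Qed.

Lemma word_poly_horner (c : 'rV['F_2]_v) e :
  (map_poly (@f2_to F) (word_poly c)).[gamma ^+ e] =
  \sum_(x <- support_points c) x ^+ e.
Proof.
rewrite big_map big_enum /= rmorph_sum /= horner_sum [RHS]big_mkcond /=.
apply: eq_bigr => i _; rewrite map_polyZ map_polyXn hornerZ hornerXn inE.
case: eqVneq => [->|/F2_eq1 ->]; first by rewrite rmorph0 mul0r.
by rewrite rmorph1 mul1r -!exprM mulnC.
Qed.

Lemma mem_cyclic_code (g : {poly 'F_2}) (c : 'rV['F_2]_v) :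
  map_poly (@f2_to F) g = \prod_(r <- code_roots) ('X - r%:P) ->
  (c \in cyclic_code v g) =
  all (fun e => \sum_(x <- support_points c) x ^+ e == 0) [:: 0; 1; 3; 2 ^ h + 1]%N.
Proof.
move=> gE; rewrite inE (dvdp_code_roots _ gE); apply: eq_all => e.
by rewrite /root word_poly_horner.
Qed.

(** A nonzero [x] satisfies [x ^+ v = 1], because its 2^m-th power is [x], and so is a power of
    [gamma]. *)
Lemma support_points_onto (t : seq F) : uniq t -> 0 \notin t ->
  exists c, perm_eq (support_points c) t.
Proof.
move=> ut t0; exists (\row_i (gamma ^+ i \in t)%:R).
apply: uniq_perm => //; first exact: uniq_support_points.
move=> x; apply/mapP/idP => [[i + ->]|xt].
  by rewrite mem_enum inE mxE; case: (_ \in t).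
have x0 : x != 0 by apply: contraNneq t0 => <-.
have xv : x ^+ v = 1.
  apply: (mulfI x0); rewrite -exprS mulr1 /v prednK ?expn_gt0 //.
  exact: frobm.
have [i xi] := prim_rootP prim xv.
by exists i; rewrite // mem_enum inE mxE -xi xt.
Qed.

(** The powers of [gamma] already give v >= 31 elements; the bound 8 is the size of a [flat]. *)
Lemma fresh_element (t : seq F) : (size t <= 8)%N -> exists x, x \notin t.
Proof.
move=> t8; pose L := [seq gamma ^+ i | i <- iota 0 v].
have uL : uniq L.
  rewrite map_inj_in_uniq ?iota_uniq // => i j; rewrite !mem_iota /= !add0n.
  by move=> iv jv /eqP; rewrite gamma_expr_eq // => /eqP.
have [/allP /(uniq_leq_size uL)|/allPn[x _ xt]] := boolP (all (mem t) L).
  rewrite size_map size_iota => /leq_trans/(_ t8).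
  have := leq_mul pow2h_ge4 pow2h_ge4; rewrite code_lengthE; lia.
by exists x.
Qed.

Lemma even_word_size (t : seq F) : \sum_(x <- t) x ^+ 0 = 0 -> ~~ odd (size t).
Proof.
under eq_bigr do rewrite expr0.
rewrite big_const_seq count_predT iter_addr_0 => /eqP.
by rewrite -(dvdn_pcharf charF) dvdn2.
Qed.

Lemma min_dist_code (g : {poly 'F_2}) :
  map_poly (@f2_to F) g = \prod_(r <- code_roots) ('X - r%:P) ->
  min_dist_is (cyclic_code v g) 8.
Proof.
move=> gE.
have powE n (x : F) : x ^+ (2 ^ n + 1) = x * frob n x by rewrite addn1 exprS.
split.
  have [x x0] := @fresh_element [:: 0] isT.
  have [y y0] := @fresh_element [:: 0; x] isT.
  have [z z0] := @fresh_element [:: 0; x; y; y + x] isT.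
  (* Choosing [a] outside the linear span makes its translate by [a] avoid 0. *)
  have [a a0] := @fresh_element (flat 0 x y z) isT.
  have u8 : uniq (flat a x y z) by rewrite inE in x0; exact: uniq_flat.
  have n0 : 0 \notin flat a x y z.
    apply: contra a0 => /mapP[u uS /esym/(char2_add_eq0 charF) ->].
    by apply/mapP; exists u; rewrite ?add0r.
  have [c cE] := support_points_onto u8 n0.
  have wc : hweight c = 8 by rewrite -size_support_points (perm_size cE).
  exists c; last first.
    split=> //; apply/eqP => c0; move: wc; rewrite /hweight c0.
    by under eq_finset do rewrite mxE eqxx; rewrite -/set0 cards0.
  rewrite (mem_cyclic_code _ gE) /= !(perm_big _ cE) /= andbT.
  apply/and4P; split; apply/eqP.
  - under eq_bigr do rewrite expr0.
    rewrite big_const_seq count_predT iter_addr_0; apply/eqP.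
    by rewrite -(dvdn_pcharf charF).
  - by under eq_bigr do rewrite expr1; exact: sum_flat.
  - under eq_bigr do rewrite (powE 1%N); exact: (sum_flat_mul (frob 1)).
  - under eq_bigr do rewrite powE; exact: (sum_flat_mul (frob h)).
move=> c; rewrite (mem_cyclic_code _ gE) /= andbT.
case/and4P=> /eqP E0 /eqP E1 /eqP E3 /eqP Eh.
apply: contraNleq => c8; have S0 : support_points c = [::].
  (* Twice h + 1 is m + 1, so [frob h.+1] applied twice is squaring. *)
  apply: (@no_small_even_word F (frob h.+1) charF).
  - move=> x; rewrite /= frob_frob.
    rewrite (_ : h.+1 + h.+1 = m + 1)%N; last by rewrite /m; lia.
    by rewrite -frob_frob frobm.
  - exact: uniq_support_points.
  - exact: even_word_size.
  - by rewrite size_support_points.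
  - by rewrite -[RHS]E1; apply: eq_bigr => x _; rewrite expr1.
  (* Applying [frob h.+1] to [x * frob h x] gives [frob h.+1 x * x], as h + (h + 1) = m. *)
  - move/(congr1 (frob h.+1)): Eh; rewrite rmorph0 rmorph_sum /= => Eh.
    rewrite -[RHS]Eh; apply: eq_bigr => x _; rewrite powE rmorphM /= frob_frob.
    by rewrite (_ : h + h.+1 = m)%N ?frobm 1?mulrC // /m; lia.
  - exact: E3.
have := size_support_points c; rewrite S0 => /esym/eqP; rewrite cards_eq0.
move=> /eqP/setP H; apply/eqP/rowP => i; move: (H i).
by rewrite !inE mxE => /negbFE/eqP.
Qed.

Lemma generator_prod (p1 p3 p5 : {poly 'F_2}) :
  is_minpoly_F2 gamma p1 -> is_minpoly_F2 (gamma ^+ 3) p3 ->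
  is_minpoly_F2 (gamma ^+ (2 ^ h + 1)) p5 ->
  map_poly (@f2_to F) (('X - 1) * p1 * p3 * p5) =
    \prod_(r <- code_roots) ('X - r%:P).
Proof.
have m0 : (0 < m)%N by rewrite /m addn1.
move=> /(minpoly_prod_conjugates m0 (frobm _)) E1.
move=> /(minpoly_prod_conjugates m0 (frobm _)) E3.
move=> /(minpoly_prod_conjugates m0 (frobm _)) E5.
have := uniq_conjugates (coprime1n v); rewrite expr1 => /E1 {}E1.
rewrite !rmorphM /= E1 E3 ?E5 ?uniq_conjugates ?coprime_length3
  ?coprime_length_pow2h1 //.
by rewrite big_cons !big_cat /= -polyC1 map_polyXsubC /= rmorph1 !mulrA.
Qed.

Lemma code_dim_code (g : {poly 'F_2}) :
  map_poly (@f2_to F) g = \prod_(r <- code_roots) ('X - r%:P) ->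
  code_dim (cyclic_code v g) = (2 ^ m - 2 - 3 * m)%N.
Proof.
move=> gE; have sg : size g = (2 + 3 * m)%N.
  by rewrite -(size_map_poly (@f2_to F)) gE size_prod_XsubC size_code_roots.
rewrite code_dim_cyclic ?sg; first by rewrite /v; lia.
  by rewrite -size_poly_eq0 sg.
(* It remains to check that the degree 1 + 3m of [g] does not exceed [v]. *)
have := ltn_expl h (isT : 1 < 2)%N; have := pow2h_ge4; have := code_lengthE.
by rewrite /m /=; nia.
Qed.

End Code.

End Char2.

Theorem theorem3 (F : finFieldType) (h : nat) (alpha : F)
  (hh : (2 <= h)%N)
  (hcard : #|F| = (2 ^ (2 * h + 1))%N)
  (halpha : ((2 ^ (2 * h + 1)).-1).-primitive_root alpha)
  (p1 p3 p5 : {poly 'F_2})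
  (hp1 : is_minpoly_F2 (alpha ^- 1) p1)
  (hp3 : is_minpoly_F2 (alpha ^- 3) p3)
  (hp5 : is_minpoly_F2 (alpha ^- (2 ^ h + 1)) p5) :
  let m := (2 * h + 1)%N in
  let v := (2 ^ m).-1 in
  let s := trace_seq m (f3 h) alpha in
  let g := ('X - 1) * p1 * p3 * p5 in
  [/\ is_seq_minpoly s g,
      (forall g', is_seq_minpoly s g' -> g' = g),
      code_dim (cyclic_code v g) = (2 ^ m - 2 - 3 * m)%N
    & min_dist_is (cyclic_code v g) 8].
Proof.
move=> m v s g.
have charF : 2%N \in [pchar F] := card_finPcharP hcard isT.
have frobm (x : F) : frob m x = x by rewrite /frob -hcard expf_card.
(* The inverse of [alpha] is its power with exponent v - 1, which is coprime to [v]. *)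
have prim : v.-primitive_root alpha^-1.
  have v0 := prim_order_gt0 halpha.
  have -> : alpha^-1 = alpha ^+ v.-1.
    apply: (mulfI (gamma_neq0 halpha)); rewrite -exprS prednK //.
    by rewrite (prim_expr_order halpha) divff ?(gamma_neq0 halpha).
  by rewrite (prim_root_exp_coprime _ halpha) coprimePn.
(* Inverses of powers become powers of the inverse, the form used with [gamma]. *)
rewrite -[alpha ^- 1]/(alpha^-1) in hp1; rewrite -!exprVn in hp3 hp5.
have gE := generator_prod charF frobm prim hh hp1 hp3 hp5.
have sE := trace_seq_code_roots charF alpha^-1 frobm; rewrite invrK in sE.
have [gmin guniq] := seq_minpoly_prod charF
  (uniq_code_roots charF frobm prim hh) (code_roots_neq0 prim) sE gE.
split=> //; first exact: (code_dim_code charF prim hh gE).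
exact: (min_dist_code charF frobm prim hh gE).
Qed.
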